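(* Let $d\ge2$ and let $X$ be a continuous random vector in $\mathbb{R}^d$ which is fully supported (the support of its distribution is all of $\mathbb{R}^d$). Let $0<\gamma<1$ and define $$M_\gamma=(1-\gamma)\,\inf_{u\in\mathbb{S}^{d-1}}\mathbb{P}\big(u^\top X\ge\|X\|\sqrt{1-\gamma^2}\big),$$ which satisfies $0<M_\gamma<1$. Let $0<\alpha<1$ satisfy $\alpha^2\in\left(1-\frac{M_\gamma}{d+1},\,1\right)$. Then $$\left\{x\in\mathbb{R}^d:\ HD(x\mid X)\ge\frac{1-\alpha^2}{M_\gamma}\right\}\subseteq\left\{q_X(\beta u):\ 0\le\beta\le\alpha,\ u\in\mathbb{S}^{d-1}\right\},$$ where $q_X(\beta u)$ is the geometric quantile of $X$ with index vector $\beta u$ and $HD(x\mid X)$ is the halfspace depth of $x$ with respect to $X$.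
   Context: $\mathbb{S}^{d-1}$ is the Euclidean unit sphere in $\mathbb{R}^d$; $\|\cdot\|$ and $\langle\cdot,\cdot\rangle$ are the Euclidean norm and inner product. ''Continuous'' random vector means that the distribution of $X$ gives zero mass to every affine hyperplane, i.e. every projection $u^\top X$, $u\in\mathbb{S}^{d-1}$, has a continuous distribution function (in particular there are no atoms). Geometric quantile: for an $\mathbb{R}^d$-valued random vector $X$ ($d>1$) whose distribution is not supported on any line, $u\in\mathbb{S}^{d-1}$ and $0\le\beta<1$, the geometric quantile $q_X(\beta u)$ is the (existing and unique) minimiser $$q_X(\beta u)=\operatorname*{arg\,min}_{q\in\mathbb{R}^d}\Big(\mathbb{E}\big[\|X-q\|-\|X\|\big]-\langle\beta u,q\rangle\Big).$$ Halfspace (Tukey) depth: $HD(x\mid X)=\inf\{\mathbb{P}(X\in H): H \text{ a closed halfspace of } \mathbb{R}^d \text{ containing } x\}$, equivalently $HD(x\mid X)=\inf_{v\in\mathbb{S}^{d-1}}\mathbb{P}(v^\top(X-x)\ge0)$. *)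

(* Defs.v *)
From mathcomp Require Import all_boot all_order all_algebra.
From mathcomp Require Import all_classical all_reals all_analysis.

Set Implicit Arguments.
Unset Strict Implicit.
Unset Printing Implicit Defensive.

Import Order.TTheory GRing.Theory Num.Theory.
Import numFieldTopology.Exports numFieldNormedType.Exports.

Local Open Scope classical_set_scope.
Local Open Scope ring_scope.

(* The library norm `|x| on 'rV[R]_d is the sup norm, hence the Euclidean
   structure below; the topology on 'rV[R]_d is nonetheless the usual one. *)
Section Euclidean.
Context {R : realType} {d : nat}.
Implicit Types x y u : 'rV[R]_d.

Definition dotp x y : R := \sum_(i < d) x ord0 i * y ord0 i.

Definition enorm x : R := Num.sqrt (dotp x x).

Definition sphere : set 'rV[R]_d := [set u | enorm u = 1].

Definition closed_halfspace (H : set 'rV[R]_d) : Prop :=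
  exists v (c : R), v != 0 /\ H = [set y | c <= dotp v y].

End Euclidean.

Section RandomVector.
Context {disp : measure_display} {T : measurableType disp} {R : realType}.
Context {d : nat}.
Variables (P : probability T R) (X : T -> 'rV[R]_d).

(* Measurability with respect to the Borel sigma-algebra of 'rV[R]_d. *)
Definition random_vector : Prop :=
  measurable_fun [set: T] (X : T -> g_sigma_algebraType (@open 'rV[R]_d)).

Definition prob_in (A : set 'rV[R]_d) : R := fine (P (X @^-1` A)).

Definition continuous_vector : Prop :=
  forall u (c : R), sphere u -> prob_in [set y | dotp u y = c] = 0.

Definition distr_support : set 'rV[R]_d :=
  [set x | forall U : set 'rV[R]_d, open U -> U x -> 0 < prob_in U].

Definition fully_supported : Prop := distr_support = [set: 'rV[R]_d].

Definition quantile_objective (v q : 'rV[R]_d) : \bar R :=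
  ('E_P[(fun w => enorm (X w - q) - enorm (X w))%R] - (dotp v q)%:E)%E.

(* q is the unique minimiser: a relation rather than a function of v, so that
   no default value arises when the minimiser fails to exist or be unique. *)
Definition is_geometric_quantile (v q : 'rV[R]_d) : Prop :=
  [set p | forall p', (quantile_objective v p <= quantile_objective v p')%E]
  = [set q].

Definition halfspace_depth (x : 'rV[R]_d) : R :=
  inf [set prob_in H | H in [set H | closed_halfspace H /\ H x]].

(* The constant M_gamma. *)
Definition cone_mass (gamma : R) : R :=
  (1 - gamma) *
  inf [set prob_in [set y | enorm y * Num.sqrt (1 - gamma ^+ 2) <= dotp u y]
      | u in sphere].

End RandomVector.

(* Main.v *)
Require Import Defs.
From mathcomp Require Import all_boot all_order all_algebra.
From mathcomp Require Import all_classical all_reals all_analysis.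
From mathcomp Require Import measurable_realfun ring lra.

(* A point x is the geometric quantile whose index vector is the mean direction
   v = E[(x - X) / |x - X|]: v is a subgradient at x of y |-> E[|X - y| - |X|],
   and the subgradient inequality is strict for y <> x because equality in
   Cauchy-Schwarz puts X on the line through x and y, hence on a hyperplane.
   For u = v / |v| the variable u.(x - X) / |x - X| is at most 1, and at most 0
   on the halfspace u.(X - x) >= 0; hence |v| <= 1 - HD(x).  Since M_gamma < 1,
   HD(x) >= (1 - alpha^2) / M_gamma gives |v| <= alpha^2 <= alpha.  Positivity
   of M_gamma is compactness of the sphere: the cones with axis near u0 all
   contain a fixed neighbourhood of u0. *)

Set Implicit Arguments.
Unset Strict Implicit.
Unset Printing Implicit Defensive.

Import Order.TTheory GRing.Theory Num.Theory.
Import numFieldTopology.Exports numFieldNormedType.Exports.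

Local Open Scope classical_set_scope.
Local Open Scope ring_scope.

(** * Euclidean geometry of row vectors, up to compactness of the sphere *)

Section EuclideanTheory.
Context {R : realType} {d : nat}.
Implicit Types (x y z u : 'rV[R]_d) (a : R).

Lemma dotpC x y : dotp x y = dotp y x.
Proof. by apply: eq_bigr => i _; rewrite mulrC. Qed.

Lemma dotpDr x y z : dotp x (y + z) = dotp x y + dotp x z.
Proof. by rewrite -big_split; apply: eq_bigr => i _; rewrite mxE mulrDr. Qed.

Lemma dotpZr a x y : dotp x (a *: y) = a * dotp x y.
Proof. by rewrite mulr_sumr; apply: eq_bigr => i _; rewrite mxE mulrCA. Qed.

Lemma dotpBr x y z : dotp x (y - z) = dotp x y - dotp x z.
Proof. by rewrite dotpDr -scaleN1r dotpZr mulN1r. Qed.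

Lemma dotpBl x y z : dotp (x - y) z = dotp x z - dotp y z.
Proof. by rewrite !(dotpC _ z) dotpBr. Qed.

Lemma dotpZl a x y : dotp (a *: x) y = a * dotp x y.
Proof. by rewrite !(dotpC _ y) dotpZr. Qed.

Lemma dotp_delta x i : dotp x (delta_mx ord0 i) = x ord0 i.
Proof.
rewrite /dotp (bigD1 i)//= big1 ?addr0 => [|j ji].
  by rewrite mxE !eqxx mulr1.
by rewrite mxE (negbTE ji) andbF mulr0.
Qed.

Lemma dotp_ge0 x : 0 <= dotp x x.
Proof. by apply: sumr_ge0 => i _; rewrite -expr2 sqr_ge0. Qed.

Lemma dotp_eq0 x : (dotp x x == 0) = (x == 0).
Proof.
apply/idP/eqP => [|->]; last by rewrite /dotp big1// => i _; rewrite mxE mul0r.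
rewrite psumr_eq0 => [/allP h|i _]; last by rewrite -expr2 sqr_ge0.
apply/rowP => i; rewrite mxE; apply/eqP.
by have := h i; rewrite mem_index_enum mulf_eq0 orbb; apply.
Qed.

Lemma enorm_ge0 x : 0 <= enorm x. Proof. exact: sqrtr_ge0. Qed.

Lemma enorm_sqr x : enorm x ^+ 2 = dotp x x.
Proof. by rewrite sqr_sqrtr// dotp_ge0. Qed.

Lemma enorm_eq0 x : (enorm x == 0) = (x == 0).
Proof. by rewrite -dotp_eq0 -enorm_sqr expf_eq0. Qed.

Lemma enorm_gt0 x : (0 < enorm x) = (x != 0).
Proof. by rewrite lt0r enorm_eq0 enorm_ge0 andbT. Qed.

Lemma enormZ a x : enorm (a *: x) = `|a| * enorm x.
Proof.
by rewrite /enorm dotpZl dotpZr mulrA -expr2 sqrtrM ?sqr_ge0// sqrtr_sqr.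
Qed.

Lemma enorm_delta i : enorm (delta_mx ord0 i : 'rV[R]_d) = 1.
Proof. by rewrite /enorm dotp_delta mxE !eqxx sqrtr1. Qed.

Lemma enormN x : enorm (- x) = enorm x.
Proof. by rewrite -scaleN1r enormZ normrN1 mul1r. Qed.

(* [unit_dir 0 = 0], since the inverse of [0] is [0]. *)
Definition unit_dir x : 'rV[R]_d := (enorm x)^-1 *: x.

Lemma sphere_unit_dir x : x != 0 -> sphere (unit_dir x).
Proof.
move=> x0; rewrite /sphere/= enormZ ger0_norm ?invr_ge0 ?enorm_ge0//.
by rewrite mulVf// enorm_eq0.
Qed.

Lemma sphere_neq0 u : sphere u -> u != 0.
Proof. by move=> u1; rewrite -enorm_eq0 u1 oner_neq0. Qed.

(** Writing the Cauchy-Schwarz gap as a squared norm yields both the inequality and its equality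
    case: no gap means that [z] vanishes. *)
Lemma CauchySchwarz_defect x y (z := enorm y *: x - enorm x *: y) :
  dotp z z = 2 * (enorm x * enorm y) * (enorm x * enorm y - dotp x y).
Proof.
rewrite /z dotpBl !dotpBr !dotpZl !dotpZr -!enorm_sqr (dotpC y x).
by ring.
Qed.

Lemma dotp_le_enorm x y : dotp x y <= enorm x * enorm y.
Proof.
(* Zero vectors are set apart so that the factor [enorm x * enorm y] of the defect is positive and
   cancels. *)
have [->|x0] := eqVneq x 0.
  by rewrite -(scale0r 0) dotpZl enormZ !(mul0r, normr0).
have [->|y0] := eqVneq y 0.
  by rewrite -(scale0r 0) dotpZr enormZ normr0 !(mul0r, mulr0).
have := dotp_ge0 (enorm y *: x - enorm x *: y).
by rewrite CauchySchwarz_defect pmulr_rge0 ?subr_ge0// !mulr_gt0 ?enorm_gt0.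
Qed.

(** Equality would give [enorm y *: x = enorm x *: y]; pairing with [u], which takes the same
    nonzero value on both vectors, makes the norms equal, hence [x = y]. *)
Lemma dotp_lt_enorm u x y : x != y -> dotp u x = dotp u y -> dotp u x != 0 ->
  dotp x y < enorm x * enorm y.
Proof.
move=> xy uxy ux0; rewrite lt_neqAle dotp_le_enorm andbT.
apply: contra xy => /eqP xy.
have := CauchySchwarz_defect x y; rewrite xy subrr mulr0 => /eqP.
rewrite dotp_eq0 => /eqP z0.
have : dotp u (enorm y *: x - enorm x *: y) == 0.
  by rewrite z0 -(scale0r 0) dotpZr mul0r.
rewrite dotpBr !dotpZr -uxy -mulrBl mulf_eq0 (negbTE ux0) orbF subr_eq0.
move=> /eqP nxy; move/eqP: z0; rewrite nxy -scalerBr scaler_eq0 subr_eq0.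
case/orP => //; rewrite enorm_eq0 => /eqP x0.
by move: ux0; rewrite x0 -(scale0r 0) dotpZr mul0r eqxx.
Qed.

(** The reverse triangle inequality; it bounds the integrand of the quantile objective, which is
    therefore integrable without any moment of [X]. *)
Lemma enormB_le x y : `|enorm (x - y) - enorm x| <= enorm y.
Proof.
have tri (a b : 'rV[R]_d) : enorm (a + b) <= enorm a + enorm b.
  rewrite -(@ler_pXn2r _ 2) ?nnegrE ?addr_ge0 ?enorm_ge0//.
  rewrite sqrrD !enorm_sqr dotpDr !(dotpC (a + b)) !dotpDr (dotpC b a).
  by have := dotp_le_enorm a b; lra.
rewrite ler_norml; apply/andP; split.
  by rewrite lerBrDl lerBlDr -{1}(subrK y x); exact: tri.
by rewrite lerBlDl -(enormN y); exact: tri.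
Qed.

Lemma exists_orthogonal z : (2 <= d)%N -> exists2 u, sphere u & dotp u z = 0.
Proof.
move=> d2.
suff [u u0 uz] : exists2 u, u != 0 & dotp u z = 0.
  exists (unit_dir u); first exact: sphere_unit_dir.
  by rewrite dotpZl uz mulr0.
pose i : 'I_d := Ordinal (ltnW d2); pose j : 'I_d := Ordinal d2.
(* If [z] vanishes at [i], the basis vector at [i] works; otherwise rotate the [(i, j)] part of [z]
   by a right angle, the entry at [j] being nonzero. *)
have [zi|zi] := eqVneq (z ord0 i) 0.
  exists (delta_mx ord0 i); last by rewrite dotpC dotp_delta.
  by apply/eqP => /rowP/(_ i)/eqP; rewrite !mxE !eqxx oner_eq0.
exists (z ord0 j *: delta_mx ord0 i - z ord0 i *: delta_mx ord0 j).
  apply/eqP => /rowP/(_ j)/eqP; rewrite !mxE !eqxx /= mulr0 sub0r mulr1.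
  by rewrite oppr_eq0 (negbTE zi).
by rewrite dotpBl !dotpZl !(dotpC (delta_mx _ _)) !dotp_delta mulrC subrr.
Qed.

Lemma dotp_unit_dir x : dotp (unit_dir x) x = enorm x.
Proof.
rewrite /unit_dir dotpZl -enorm_sqr.
have [->|x0] := eqVneq (enorm x) 0; first by rewrite expr0n mulr0.
by rewrite expr2 mulKf.
Qed.

Lemma enorm_unit_dir_le x : enorm (unit_dir x) <= 1.
Proof.
rewrite /unit_dir enormZ ger0_norm ?invr_ge0 ?enorm_ge0//.
have [->|x0] := eqVneq (enorm x) 0; first by rewrite mulr0.
by rewrite mulVf.
Qed.

(** [unit_dir x] is a subgradient of the norm at [x], including [x = 0]: it pairs with [x] to
    [enorm x] and has norm at most 1. *)
Lemma dotp_unit_dir_le x y : dotp (unit_dir x) y <= enorm y.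
Proof.
rewrite (le_trans (dotp_le_enorm _ _))//.
by rewrite ler_piMl ?enorm_ge0 ?enorm_unit_dir_le.
Qed.

Lemma coord_unit_dir_le x i : `|unit_dir x ord0 i| <= 1.
Proof.
rewrite ler_norml -dotp_delta -(enorm_delta i) dotp_unit_dir_le andbT.
rewrite lerNl -mulN1r -dotpZr scaleN1r -(enormN (delta_mx _ _)).
exact: dotp_unit_dir_le.
Qed.

Lemma dotp_unit_dir_lt u x y : x != y -> dotp u x = dotp u y -> dotp u x != 0 ->
  dotp (unit_dir x) y < enorm y.
Proof.
move=> xy uxy ux; have x0 : 0 < enorm x.
  rewrite enorm_gt0; apply: contraNneq ux => ->.
  by rewrite -(scale0r 0) dotpZr mul0r.
by rewrite /unit_dir dotpZl mulrC ltr_pdivrMr// mulrC (dotp_lt_enorm xy uxy).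
Qed.

(** Joint continuity is what the compactness argument for cones needs, since axis and point move
    together there. *)
Lemma dotp_continuous :
  continuous (fun p : 'rV[R]_d * 'rV[R]_d => dotp p.1 p.2).
Proof.
move=> p; apply: cvg_big => [|i _]; first exact: add_continuous.
apply: cvgM.
  by apply: (@cvg_comp _ _ _ fst (fun x : 'rV[R]_d => x ord0 i));
    [exact: cvg_fst|exact: coord_continuous].
by apply: (@cvg_comp _ _ _ snd (fun x : 'rV[R]_d => x ord0 i));
  [exact: cvg_snd|exact: coord_continuous].
Qed.

Lemma dotpr_continuous u : continuous (dotp u).
Proof.
move=> x.
apply: (@continuous2_cvg _ _ _ _ _ (nbhs_filter x) _ _ (@dotp R d) u x).
- exact: (@dotp_continuous (u, x)).
- exact: cvg_cst.
- exact: cvg_id.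
Qed.

Lemma enorm_continuous : continuous (@enorm R d).
Proof.
move=> x; apply: continuous_comp; last exact: sqrt_continuous.
apply: (@continuous2_cvg _ _ _ _ _ (nbhs_filter x) _ _ (@dotp R d) x x).
- exact: (@dotp_continuous (x, x)).
- exact: cvg_id.
- exact: cvg_id.
Qed.

Lemma closed_ge0_preimage (f : 'rV[R]_d -> R) :
  continuous f -> closed [set y | 0 <= f y].
Proof.
by move=> cf; apply: (@closed_comp _ _ f [set r | 0 <= r]) => [x _|];
  [exact: cf|exact: closed_ge].
Qed.

Lemma sphere_compact : compact (@sphere R d).
Proof.
(* The sphere is closed in the cube of side [[-1, 1]], a compact product of segments. *)
apply: (@subclosed_compact _ _
  [set v : 'rV[R]_d | forall i : 'I_d, `[-1, 1]%classic (v ord0 i)]).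
- by apply: (@closed_comp _ _ (@enorm R d) [set r | r = 1]) => [x _|];
    [exact: enorm_continuous|exact: closed_eq].
- apply: (@rV_compact R d (fun=> `[-1, 1]%classic)) => i.
  exact: segment_compact.
- move=> u u1 i /=; rewrite in_itv/= -ler_norml.
  rewrite -(@expr_le1 _ 2)// real_normK ?num_real// -(expr1n _ 2) -u1 enorm_sqr.
  rewrite /dotp (bigD1 i)//= -expr2 lerDl sumr_ge0// => j _.
  by rewrite -expr2 sqr_ge0.
Qed.

End EuclideanTheory.

(** * Integrals of real functions under a probability *)

Section Expectation.
Context {disp : measure_display} {T : measurableType disp} {R : realType}.
Variable P : probability T R.
Implicit Types f : T -> R.

Lemma bounded_integrable f (b : R) :
  measurable_fun setT f -> (forall w, `|f w| <= b) ->
  P.-integrable setT (EFin \o f).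
Proof.
move=> mf fb; apply: measurable_bounded_integrable => //.
  by rewrite -ge0_fin_numE// fin_num_measure.
exists b; split; first exact: num_real.
by move=> M bM w _ /=; apply: (le_trans (fb w)); exact: ltW.
Qed.

Lemma expectation_Rintegral f : P.-integrable setT (EFin \o f) ->
  'E_P[f]%E = (\int[P]_w f w)%:E.
Proof. by move=> fi; rewrite unlock fineK// integrable_fin_num. Qed.

(** A zero integral would make [f] vanish almost everywhere, so the whole space would be covered by
    two null sets, against total mass 1. *)
Lemma Rintegral_gt0 f : P.-integrable setT (EFin \o f) ->
  (forall w, 0 <= f w) -> P [set w | f w = 0] = 0%E -> 0 < \int[P]_w f w.
Proof.
move=> fi f0 Pf0; rewrite lt_neqAle Rintegral_ge0// andbT.
apply/eqP => int0.
have mf := measurable_int _ fi.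
have : ae_eq P setT (EFin \o f) (cst 0%E).
  apply/(ae_eq_integral_abs P measurableT mf).
  under eq_integral => w _ do rewrite /= ger0_norm//.
  by rewrite -[LHS]fineK ?integrable_fin_num// -[fine _]int0.
move=> [N [mN PN0 fN]].
have mf0 : measurable [set w | f w = 0].
  rewrite -[X in measurable X]setTI.
  by have /measurable_EFinP mf' := mf; exact: (mf' measurableT [set 0]).
have : (P setT <= P N + P [set w | f w = 0%R])%E.
  rewrite (le_trans _ (measureU2 _ mN mf0))// le_measure ?inE//.
    exact: measurableU.
  move=> w _; have [|nN] := pselect (N w); [by left|right] => /=.
  by apply: contra_notP nN => fw; apply: fN => /= /(_ I)[].
by rewrite [X in (X <= _)%E](probability_setT P) PN0 Pf0 add0e lee_fin ler10.
Qed.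

Lemma Rintegral_sum n (f : 'I_n -> T -> R) :
  (forall i, P.-integrable setT (EFin \o f i)) ->
  \int[P]_w (\sum_(i < n) f i w) = \sum_(i < n) \int[P]_w f i w.
Proof.
move=> fi; rewrite /Rintegral sum_fine => [|i _]; last first.
  by apply: integrable_fin_num => //; exact: fi.
rewrite -(integral_sum measurableT fi); congr fine.
by apply: eq_integral => w _; rewrite sumEFin.
Qed.

Lemma measurable_funV f : measurable_fun setT f -> (forall w, 0 <= f w) ->
  measurable_fun setT (fun w => (f w)^-1).
Proof.
move=> mf f0; rewrite (_ : (fun _ => _) = (@powR R ^~ (-1)) \o f).
  exact: measurableT_comp.
by apply/funext => w /=; rewrite powR_inv1.
Qed.

End Expectation.

(** * Measurability of events of [X], and halfspace masses *)

Section RandomVectorTheory.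
Context {disp : measure_display} {T : measurableType disp} {R : realType}.
Context {d : nat}.
Variables (P : probability T R) (X : T -> 'rV[R]_d).
Hypothesis X_rv : random_vector X.
Implicit Types (u v x y q : 'rV[R]_d) (A B : set 'rV[R]_d).

Lemma measurable_preimage_open A : open A -> measurable (X @^-1` A).
Proof.
move=> oA; rewrite -[X in measurable X]setTI.
by apply: X_rv => //; exact: sub_sigma_algebra.
Qed.

Lemma measurable_preimage_closed A : closed A -> measurable (X @^-1` A).
Proof.
move=> cA; rewrite -[A]setCK preimage_setC; apply: measurableC.
exact: (@measurable_preimage_open (~` A) (closed_openC cA)).
Qed.

Lemma measurable_fun_continuous (f : 'rV[R]_d -> R) :
  continuous f -> measurable_fun setT (f \o X).
Proof.
move=> cf; apply: (measurability _ (RGenOpens.measurableE R)).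
(* Open intervals generate the Borel sets of the line, and their preimages under [f] are open. *)
move=> _ [_ [a [b ->]] <-]; rewrite setTI comp_preimage.
apply: measurable_preimage_open; apply: open_comp => [x _|]; first exact: cf.
exact: itv_open.
Qed.

Lemma prob_in_ge0 A : 0 <= prob_in P X A.
Proof. exact: fine_ge0. Qed.

Lemma prob_inK A : measurable (X @^-1` A) -> P (X @^-1` A) = (prob_in P X A)%:E.
Proof. by move=> mA; rewrite /prob_in fineK// fin_num_measure. Qed.

Lemma prob_in_le1 A : measurable (X @^-1` A) -> prob_in P X A <= 1.
Proof. by move=> mA; rewrite -lee_fin -prob_inK// probability_le1. Qed.

Lemma le_prob_in A B : measurable (X @^-1` A) -> measurable (X @^-1` B) ->
  A `<=` B -> prob_in P X A <= prob_in P X B.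
Proof.
move=> mA mB AB; rewrite -lee_fin -!prob_inK// le_measure ?inE//.
exact: preimage_subset.
Qed.

Lemma halfspace_depth_le u x : u != 0 ->
  halfspace_depth P X x <= prob_in P X [set y | dotp u x <= dotp u y].
Proof.
(* The halfspace with [x] on its boundary competes in the infimum, which is genuine because masses
   are bounded below by 0. *)
move=> u0; apply: ge_inf; first by exists 0 => _ [H _ <-]; exact: prob_in_ge0.
exists [set y | dotp u x <= dotp u y] => //.
by split => //=; exists u, (dotp u x).
Qed.

End RandomVectorTheory.

(** * Cone masses, then the mean direction as index vector of a quantile *)

Section QuantileDepth.
Context {disp : measure_display} {T : measurableType disp} {R : realType}.
Context {d : nat}.
Variables (P : probability T R) (X : T -> 'rV[R]_d).
Hypothesis X_rv : random_vector X.
Implicit Types (u v x y q : 'rV[R]_d) (A B : set 'rV[R]_d).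

(** For a unit vector [u] and [s] in [[-1, 1]], the circular cone about [u] with half-angle
    [arccos s]. *)
Definition cone u (s : R) : set 'rV[R]_d := [set y | enorm y * s <= dotp u y].

Lemma measurable_preimage_cone u s : measurable (X @^-1` cone u s).
Proof.
apply: measurable_preimage_closed => //.
rewrite (_ : cone u s = [set y | 0 <= dotp u y - enorm y * s]).
  apply: closed_ge0_preimage => y.
  apply: (cvgB (FF := nbhs_filter y)); first exact: dotpr_continuous.
  apply: (cvgM (FF := nbhs_filter y)); first exact: enorm_continuous.
  exact: cvg_cst.
by apply/seteqP; split => y /=; rewrite subr_ge0.
Qed.

Lemma prob_cone_lbound (s : R) : s < 1 -> fully_supported P X ->
  exists2 m : R, 0 < m & forall u, sphere u -> m <= prob_in P X (cone u s).
Proof.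
move=> s1 Xfull.
(* Near-covering form of compactness: if all small [m > 0] are lower bounds near each axis, then
   some [m > 0] is one for all axes. *)
have := @sphere_compact R d; rewrite compact_near_coveringP.
move=> /(_ R 0^'+ (fun m u => m <= prob_in P X (cone u s)) _) near_cover.
have [] : \forall m \near 0^'+,
    @sphere R d `<=` (fun u => m <= prob_in P X (cone u s)).
  apply: near_cover => u u1.
  (* At [(u, u)] this expression equals [1 - s > 0]. *)
  have : \forall p \near (u, u), 0 < dotp p.1 p.2 - enorm p.2 * s.
    pose f (p : 'rV[R]_d * 'rV[R]_d) := dotp p.1 p.2 - enorm p.2 * s.
    have cf : f p @[p --> (u, u)] --> f (u, u).
      apply: cvgB; first exact: (@dotp_continuous _ _ (u, u)).
      apply: cvgM; last exact: cvg_cst.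
      apply: (@cvg_comp _ _ _ snd (@enorm R d)); first exact: cvg_snd.
      exact: enorm_continuous.
    apply: (cf [set r | 0 < r]); apply: open_nbhs_nbhs.
    split; first exact: open_gt.
    by rewrite /f /= -enorm_sqr u1 expr1n mul1r subr_gt0.
  move=> [[/= U V] [nU nV] UV].
  (* [V°] lies in the cone about every axis in [U], so its mass bounds all those cone masses from
     below. *)
  have pV : 0 < prob_in P X V°.
    have : distr_support P X u by rewrite Xfull.
    by apply; [exact: open_interior|exact: nV].
  exists (U, [set m | m <= prob_in P X V°]) => /=.
    by split => //; exact: nbhs_right_le.
  move=> [u' m] /= [Uu' mV]; apply: (le_trans mV).
  apply: le_prob_in => //.
  - by apply: measurable_preimage_open => //; exact: open_interior.
  - exact: measurable_preimage_cone.
  - move=> y /interior_subset Vy; rewrite /cone/= -subr_ge0 ltW//.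
    exact: (UV (u', y)).
move=> e /= e0 em; exists (e / 2); first by rewrite divr_gt0.
move=> u u1; apply: (em (e / 2)) => //=.
  by rewrite sub0r normrN ger0_norm ?divr_ge0 ?(ltW e0)//; lra.
by rewrite divr_gt0.
Qed.

Lemma cone_mass_bounds (gamma : R) : (0 < d)%N -> fully_supported P X ->
  0 < gamma < 1 -> 0 < cone_mass P X gamma < 1.
Proof.
move=> d0 Xfull /andP[g0 g1].
have s1 : Num.sqrt (1 - gamma ^+ 2) < 1.
  rewrite -[ltRHS]sqrtr1 ltr_sqrt ?ltr01//.
  by rewrite ltrBlDr ltrDl exprn_gt0.
have [m m0 mP] := prob_cone_lbound s1 Xfull.
(* A basis vector makes the set of cone masses nonempty, so its [inf] is not a default value. *)
pose e : 'rV[R]_d := delta_mx ord0 (Ordinal d0).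
have e1 : sphere e by exact: enorm_delta.
rewrite /cone_mass; set E := [set _ | _ in _].
have Ee : E (prob_in P X (cone e (Num.sqrt (1 - gamma ^+ 2)))) by exists e.
have mE : m <= inf E.
  by apply: lb_le_inf; [eexists; exact: Ee|move=> _ [u u1 <-]; exact: mP].
have E1 : inf E <= 1.
  apply: le_trans (prob_in_le1 _ (measurable_preimage_cone e _)).
  by apply: ge_inf Ee; exists m => _ [u u1 <-]; exact: mP.
apply/andP; split; first by rewrite mulr_gt0 ?subr_gt0// (lt_le_trans m0).
apply: (@le_lt_trans _ _ (1 - gamma)); last by rewrite gtrBl.
by rewrite ler_piMr// subr_ge0 ltW.
Qed.

(** The expectation of a vector, taken coordinatewise; outcomes with [X w = x] contribute 0. *)
Definition mean_direction x : 'rV[R]_d :=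
  \row_i \int[P]_w unit_dir (x - X w) ord0 i.

Lemma unit_dir_integrable x i :
  P.-integrable setT (EFin \o (fun w => unit_dir (x - X w) ord0 i)).
Proof.
apply: (@bounded_integrable _ _ _ P _ 1) => [|w]; last exact: coord_unit_dir_le.
have mB (f : 'rV[R]_d -> R) : continuous f ->
    measurable_fun setT (fun w => f (x - X w)).
  move=> cf; apply: (measurable_fun_continuous X_rv (f := fun y => f (x - y))).
  move=> y; apply: (@cvg_comp _ _ _ (fun y => x - y) f); last exact: cf.
  by apply: (cvgB (FF := nbhs_filter y)); [exact: cvg_cst|exact: cvg_id].
rewrite (_ : (fun _ => _) =
  (fun w => (enorm (x - X w))^-1 * (fun y : 'rV[R]_d => y ord0 i) (x - X w))).
  apply: measurable_funM.
    apply: measurable_funV => [|w]; last exact: enorm_ge0.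
    exact: (mB (@enorm R d) (@enorm_continuous R d)).
  exact: (mB (fun y => y ord0 i) (@coord_continuous R 1 d ord0 i)).
by apply/funext => w; rewrite !mxE.
Qed.

Lemma dotp_unit_dir_integrable x z :
  P.-integrable setT (EFin \o (fun w => dotp (unit_dir (x - X w)) z)).
Proof.
rewrite (_ : EFin \o _ = fun w =>
  (\sum_(i < d) ((unit_dir (x - X w) ord0 i)%:E * (z ord0 i)%:E))%E).
  apply: integrable_sum => // i _; apply: integrableZr => //.
  exact: unit_dir_integrable.
by apply/funext => w /=; rewrite -sumEFin.
Qed.

Lemma Rintegral_dotp_unit_dir x z :
  \int[P]_w dotp (unit_dir (x - X w)) z = dotp (mean_direction x) z.
Proof.
rewrite /dotp Rintegral_sum => [|i].
  apply: eq_bigr => i _; rewrite mxE RintegralZr//.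
  exact: unit_dir_integrable.
by have := integrableZr measurableT (z ord0 i) (unit_dir_integrable x i).
Qed.

Lemma mean_direction_le x : mean_direction x != 0 ->
  enorm (mean_direction x) <= 1 - halfspace_depth P X x.
Proof.
set v := mean_direction x => v0.
have u1 : sphere (unit_dir v) by exact: sphere_unit_dir.
pose A := [set y | dotp (unit_dir v) x <= dotp (unit_dir v) y].
have cA : closed A.
  by apply: (@closed_comp _ _ (dotp (unit_dir v)) [set r | _ <= r]) => [y _|];
    [exact: dotpr_continuous|exact: closed_ge].
have mA : measurable (X @^-1` A) by exact: measurable_preimage_closed.
apply: (@le_trans _ _ (1 - prob_in P X A)); last first.
  by rewrite lerB// halfspace_depth_le// sphere_neq0.
(* The bound becomes the integral of an indicator, so that it can be compared pointwise with the
   integrand of [enorm v]. *)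
have <- : \int[P]_w \1_(X @^-1` ~` A) w = 1 - prob_in P X A.
  rewrite /Rintegral integral_indic//; last first.
    by rewrite preimage_setC; exact: measurableC.
  rewrite setIT preimage_setC.
  apply: (congr1 fine (y := (1 - prob_in P X A)%:E)).
  by rewrite EFinB -prob_inK//; exact: probability_setC.
(* [enorm v] is the pairing of [v] with its own direction, hence the mean of the pairing of that
   direction with [unit_dir (x - X w)]. *)
rewrite -dotp_unit_dir dotpC -Rintegral_dotp_unit_dir.
apply: le_Rintegral => //.
- exact: dotp_unit_dir_integrable.
- by apply: integrable_indic; rewrite preimage_setC; exact: measurableC.
move=> w _; rewrite indicE.
have [/set_mem Aw|Aw] := boolP (w \in _).
  by rewrite (le_trans (dotp_unit_dir_le _ _))// u1.
have {}Aw : A (X w).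
  by apply: contrapT => nA; move/negP: Aw; apply; exact/mem_set.
rewrite dotpZl mulr_ge0_le0 ?invr_ge0 ?enorm_ge0// dotpC dotpBr subr_le0.
exact: Aw.
Qed.

Lemma mean_direction_quantile x : (2 <= d)%N -> continuous_vector P X ->
  is_geometric_quantile P X (mean_direction x) x.
Proof.
move=> d2 Xc; set v := mean_direction x.
pose L y w := enorm (X w - y) - enorm (X w).
have Lm y : measurable_fun setT (L y).
  apply: (measurable_fun_continuous X_rv
    (f := fun z => enorm (z - y) - enorm z)) => z.
  apply: (cvgB (FF := nbhs_filter z)); last exact: enorm_continuous.
  apply: (@cvg_comp _ _ _ (fun z => z - y) (@enorm R d));
    last exact: enorm_continuous.
  by apply: (cvgB (FF := nbhs_filter z)); [exact: cvg_id|exact: cvg_cst].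
have Li y : P.-integrable setT (EFin \o L y).
  by apply: (@bounded_integrable _ _ _ P _ (enorm y)) => // w; exact: enormB_le.
have QE y : quantile_objective P X v y = (\int[P]_w L y w - dotp v y)%:E.
  by rewrite /quantile_objective (expectation_Rintegral (Li y)) EFinB.
suff Qlt y : y != x ->
    \int[P]_w L x w - dotp v x < \int[P]_w L y w - dotp v y.
  apply/seteqP; split => [y /= miny|y /= -> y'].
    apply: contrapT => /eqP yx; have := miny x.
    by rewrite !QE lee_fin leNgt Qlt.
  rewrite !QE lee_fin; have [->//|y'x] := eqVneq y' x.
  by rewrite ltW// Qlt.
move=> yx.
(* [D] is the pointwise gap in the subgradient inequality; its integral is the excess of the
   objective at [y] over that at [x]. *)
pose D w := enorm (y - X w) - dotp (unit_dir (x - X w)) (y - X w).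
have DE w : D w = L y w - L x w - dotp (unit_dir (x - X w)) (y - x).
  rewrite /D /L -(enormN (X w - y)) -(enormN (X w - x)) ![- (X w - _)]opprB.
  have -> : y - X w = (x - X w) + (y - x) by rewrite [RHS]addrC subrKA.
  by rewrite [in LHS]dotpDr dotp_unit_dir; ring.
have Bi : P.-integrable setT (EFin \o (fun w => L y w - L x w)).
  exact: (integrableB measurableT (Li y) (Li x)).
have Di : P.-integrable setT (EFin \o D).
  rewrite (funext DE).
  exact: (integrableB measurableT Bi (dotp_unit_dir_integrable x (y - x))).
have : 0 < \int[P]_w D w.
  apply: Rintegral_gt0 => // [w|]; first by rewrite subr_ge0 dotp_unit_dir_le.
  (* The hyperplane through [x] normal to [u] contains the line through [x] and [y]; off it the gap
     is strict, and it has mass 0 by continuity of [X]. *)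
  have [u u1 uyx] := exists_orthogonal (y - x) d2.
  have mD : measurable [set w | D w = 0].
    have /measurable_EFinP mD := measurable_int _ Di.
    by rewrite -[X in measurable X]setTI; exact: (mD measurableT [set 0]).
  have clH : closed [set z | dotp u z = dotp u x].
    by apply: (@closed_comp _ _ (dotp u) [set r | r = dotp u x]) => [z _|];
      [exact: dotpr_continuous|exact: closed_eq].
  have mH := measurable_preimage_closed X_rv clH.
  have PH0 : P (X @^-1` [set z | dotp u z = dotp u x]) = 0%E.
    by rewrite prob_inK// Xc.
  apply: (subset_measure0 mD mH) PH0.
  move=> w /= /eqP; rewrite subr_eq0 => /eqP Dw.
  apply: contrapT => /eqP uX.
  have := @dotp_unit_dir_lt _ _ u (x - X w) (y - X w).
  rewrite -Dw ltxx => h; suff : false by []; apply: h.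
  - by rewrite (inj_eq (addIr _)) eq_sym.
  - by move/eqP: uyx; rewrite !dotpBr subr_eq0 => /eqP ->.
  - by rewrite dotpBr subr_eq0 eq_sym.
have -> : \int[P]_w D w =
    \int[P]_w L y w - \int[P]_w L x w - dotp v (y - x).
  rewrite -Rintegral_dotp_unit_dir -RintegralB// -RintegralB//.
    by apply: eq_Rintegral => w _; rewrite DE.
  exact: dotp_unit_dir_integrable.
by rewrite dotpBr; lra.
Qed.

End QuantileDepth.

Theorem theorem3p3 (R : realType) (d : nat) (disp : measure_display)
    (T : measurableType disp) (P : probability T R) (X : T -> 'rV[R]_d)
    (gamma : R) :
  (2 <= d)%N ->
  random_vector X ->
  continuous_vector P X ->
  fully_supported P X ->
  0 < gamma < 1 ->
  0 < cone_mass P X gamma < 1 /\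
  forall alpha : R,
    0 < alpha < 1 ->
    1 - cone_mass P X gamma / d.+1%:R < alpha ^+ 2 < 1 ->
    [set x : 'rV[R]_d |
       (1 - alpha ^+ 2) / cone_mass P X gamma <= halfspace_depth P X x]
    `<=`
    [set q : 'rV[R]_d | exists (beta : R) (u : 'rV[R]_d),
       [/\ 0 <= beta <= alpha, sphere u &
           is_geometric_quantile P X (beta *: u) q]].
Proof.
move=> d2 X_rv Xc Xfull gamma01.
have Mbounds := cone_mass_bounds X_rv (ltnW d2) Xfull gamma01.
split=> // alpha /andP[a0 a1] _ x /=.
have /andP[M0 M1] := Mbounds; set M := cone_mass _ _ _ in M0 M1 *.
move=> HDx.
have HD_ge : 1 - alpha ^+ 2 <= halfspace_depth P X x.
  apply: le_trans HDx; rewrite ler_pdivlMr// ler_piMr ?ltW//.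
  by rewrite subr_gt0 expr_lt1// ltW.
have := mean_direction_quantile X_rv x d2 Xc.
set v := mean_direction P X x => xq.
(* A zero mean direction gives [beta = 0] with an arbitrary unit vector; otherwise [v] splits into
   its norm and its direction. *)
have [v0|v0] := eqVneq v 0.
  have [u u1 _] := exists_orthogonal (0 : 'rV[R]_d) d2.
  by exists 0, u; split; rewrite ?lexx ?(ltW a0) ?scale0r -?v0.
exists (enorm v), (unit_dir v); split.
- rewrite enorm_ge0 (le_trans (mean_direction_le X_rv v0))//.
  rewrite (@le_trans _ _ (alpha ^+ 2))//; first by lra.
  by rewrite expr2 ler_piMr// ltW.
- exact: sphere_unit_dir.
- by rewrite /unit_dir scalerA divff ?enorm_eq0// scale1r.
Qed.
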